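(* Let $\mathbb{X}=(X,\mathcal{M},\mu)$ be a nontrivial semifinite measure space with a collection of generators $\mathscr{G}$. Then $$L^\infty(\mathbb{X})\subset\log A_2(\mathbb{X},\mathscr{G})\subset\mathrm{BMO}_{\mathscr{G}}(\mathbb{X}).$$
   Context: Setting: $\mathbb{X}=(X,\mathcal{M},\mu)$ is a nontrivial (i.e. $\mu(X)>0$) semifinite measure space, $\mathcal{M}^*=\{E\in\mathcal{M}:0<\mu(E)<\infty\}$, and the collection of generators $\mathscr{G}\subset\mathcal{M}^*$ covers $X$. $L^1_{\mathrm{loc}}(\mathbb{X},\mathscr{G})$ is the space of measurable $f:X\to\mathbb{R}$ with $\int_G|f|\,d\mu<\infty$ for every $G\in\mathscr{G}$; $f_G=\frac1{\mu(G)}\int_G f\,d\mu$. $\mathrm{BMO}_{\mathscr{G}}(\mathbb{X})$ is the set of $f\in L^1_{\mathrm{loc}}(\mathbb{X},\mathscr{G})$ with $\sup_{G\in\mathscr{G}}\frac1{\mu(G)}\int_G|f-f_G|\,d\mu<\infty$. A nonnegative measurable function $w$ is in $A_2(\mathbb{X},\mathscr{G})$ if $\sup_{G\in\mathscr{G}}\left(\frac1{\mu(G)}\int_G w\,d\mu\right)\left(\frac1{\mu(G)}\int_G w^{-1}\,d\mu\right)<\infty$. A measurable $f:X\to\mathbb{R}$ is in $\log A_2(\mathbb{X},\mathscr{G})$ if $e^f\in A_2(\mathbb{X},\mathscr{G})$. $L^\infty(\mathbb{X})$ is the space of real-valued essentially bounded measurable functions. *)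

(* Defs.v *)
From HB Require Import structures.
From mathcomp Require Import all_boot all_order all_algebra.
From mathcomp Require Import all_classical all_reals all_analysis.

Set Implicit Arguments.
Unset Strict Implicit.
Unset Printing Implicit Defensive.

Import Order.TTheory GRing.Theory Num.Theory.
Import numFieldNormedType.Exports.

Local Open Scope classical_set_scope.
Local Open Scope ring_scope.
Local Open Scope ereal_scope.

Section BMO.
Context {d : measure_display} {T : measurableType d} {R : realType}.
Variable mu : {measure set T -> \bar R}.

Definition semifinite : Prop := forall E : set T,
  measurable E -> mu E = +oo ->
  exists F : set T, [/\ measurable F, F `<=` E & 0 < mu F < +oo].

Definition measurable_pos_finite : set (set T) :=
  [set E | measurable E /\ 0 < mu E < +oo].

Definition generators (GG : set (set T)) : Prop :=
  GG `<=` measurable_pos_finite /\ \bigcup_(G in GG) G = [set: T].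

(* Below, the sets G range over generators, so that mu G is a positive real. *)

Definition L1loc (GG : set (set T)) : set (T -> R) :=
  [set f : T -> R | measurable_fun [set: T] f /\
    forall G, GG G -> \int[mu]_(x in G) `|f x|%:E < +oo].

(* Real-valued, hence meaningful only when f is integrable on G. *)
Definition mean (f : T -> R) (G : set T) : R :=
  ((\int[mu]_(x in G) f x) / fine (mu G))%R.

Definition BMO (GG : set (set T)) : set (T -> R) :=
  [set f : T -> R | L1loc GG f /\
    ereal_sup [set (mu G)^-1 * \int[mu]_(x in G) `|f x - mean f G|%:E
              | G in GG] < +oo].

(* The reciprocal of w is taken in \bar R, where 0^-1 = +oo; the inverse of
   the field R would give 0. In the product, 0 * +oo = 0, which only matters
   when w vanishes almost everywhere on G. *)
Definition A2 (GG : set (set T)) : set (T -> R) :=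
  [set w : T -> R | [/\ measurable_fun [set: T] w, (forall x, (0 <= w x)%R) &
    ereal_sup [set ((mu G)^-1 * \int[mu]_(x in G) (w x)%:E) *
                   ((mu G)^-1 * \int[mu]_(x in G) ((w x)%:E)^-1)
              | G in GG] < +oo]].

Definition logA2 (GG : set (set T)) : set (T -> R) :=
  [set f : T -> R | measurable_fun [set: T] f /\ A2 GG (fun x => expR (f x))].

Definition Linfty : set (T -> R) := [set f : T -> R | f \in Lfun mu +oo].

End BMO.

(* Main.v *)
Require Import Defs.
From mathcomp Require Import all_boot all_order all_algebra.
From mathcomp Require Import all_classical all_reals all_analysis.
From mathcomp Require Import ess_sup_inf measurable_realfun lra.

(** Both inclusions hold one generator at a time; each generator [G] has
    positive finite measure, so averages over [G] make sense.

    If [|f| <= M] almost everywhere, then [e^f] and [e^(-f)] are both at most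
    [e^M] almost everywhere, so every product of averages in the [A_2]
    condition for [e^f] is at most [e^(2M)].

    Conversely, let [a] and [b] be the averages over [G] of [e^f] and [e^(-f)],
    with [a * b] finite. Both are positive because exponentials are positive and
    [mu G > 0], hence both are finite ([integrable_expR_of_average_mul]), and
    [f] is integrable on [G] because [|f| <= e^f + e^(-f)]. Let [m] be the mean
    of [f] over [G]. Jensen's inequality ([mean_expR_ge1]), applied to [f] and to
    [-f], says that [A := a * e^(-m)] and [B := b * e^m] are at least [1]. Since
    [|t| <= e^t + e^(-t) - 1], the mean of [|f - m|] is at most [A + B - 1], and
    [A + B - 1 <= A * B = a * b] because [(A - 1) * (B - 1) >= 0]. So the mean
    oscillation of [f] over [G] is bounded by the [A_2] product of [e^f] over
    [G] itself ([mean_oscillation_le]), with no loss of constant. *)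

Import Order.TTheory GRing.Theory Num.Theory.

Local Open Scope classical_set_scope.
Local Open Scope ring_scope.

(** One of the two exponentials is at least [1 + |t|] and the other is positive.
    The constant [- 1] is what makes [mean_oscillation_le] lossless. *)
Lemma normr_le_expRDB1 (R : realType) (t : R) :
  `|t| <= expR t + expR (- t) - 1.
Proof.
have := expR_ge1Dx t; have := expR_ge1Dx (- t).
have := expR_gt0 t; have := expR_gt0 (- t).
by case: (ger0P t) => _; lra.
Qed.

(** Positivity of [y] excludes [+oo * 0 = 0]. *)
Lemma lty_pmul (R : realType) (x y : \bar R) :
  (0 < x -> 0 < y -> x * y < +oo -> x < +oo)%E.
Proof.
case: x => [r||] // _ y0; first by rewrite ltry.
by rewrite gt0_mulye.
Qed.

(** As [e^t] never vanishes, the extended reciprocal in the [A_2] condition of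
    [e^f] is the ordinary one, and that condition is symmetric in [f] and
    [-f]. *)
Lemma inve_expR (R : realType) (t : R) :
  ((expR t)%:E^-1 = (expR (- t))%:E)%E.
Proof. by rewrite inver gt_eqF ?expR_gt0// expRN. Qed.

Section averages.
Context {d : measure_display} {T : measurableType d} {R : realType}.
Variables (mu : {measure set T -> \bar R}) (G : set T).
Hypotheses (mG : measurable G) (muG : (0 < mu G < +oo)%E).

Let muG_fin : mu G \is a fin_num.
Proof. by case/andP: muG => G0 Goo; rewrite ge0_fin_numE ?ltW. Qed.

Let fine_muG_gt0 : 0 < fine (mu G).
Proof. exact: fine_gt0. Qed.

Let inve_muG : ((mu G)^-1 = ((fine (mu G))^-1)%:E)%E.
Proof. by rewrite -[in LHS](fineK muG_fin) inver gt_eqF. Qed.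

Lemma integrable_cstG (c : R) : mu.-integrable G (EFin \o cst c).
Proof.
apply/integrableP; split; first exact/measurable_EFinP.
have /= -> := integral_cst mu mG `|c|%:E.
by rewrite -(fineK muG_fin) ltry.
Qed.

Lemma mean_EFin (g : T -> R) : mu.-integrable G (EFin \o g) ->
  ((mu G)^-1 * \int[mu]_(x in G) (g x)%:E = (mean mu g G)%:E)%E.
Proof.
move=> ig; rewrite /mean /Rintegral inve_muG EFinM muleC fineK//.
exact: integrable_fin_num ig.
Qed.

Lemma average_le_ae (g : T -> R) (c : R) :
  measurable_fun setT g -> (forall x, 0 <= g x) -> 0 <= c ->
  (\forall x \ae mu, g x <= c) ->
  ((mu G)^-1 * \int[mu]_(x in G) (g x)%:E <= c%:E)%E.
Proof.
move=> mg g0 c0 gc.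
rewrite inve_muG muleC lee_pdivrMr// (fineK muG_fin) -(integral_cst mu mG).
apply: ae_ge0_le_integral => //.
- by move=> x _; rewrite lee_fin.
- by apply/measurable_EFinP; exact: measurable_funTS.
- by apply: filterS gc => x gxc _; rewrite lee_fin.
Qed.

(** A nonnegative function with zero integral over [G] vanishes almost
    everywhere on [G]; an exponential vanishes nowhere, and [G] is not null. *)
Lemma integral_expR_gt0 (f : T -> R) : measurable_fun setT f ->
  (0 < \int[mu]_(x in G) (expR (f x))%:E)%E.
Proof.
move=> mf.
have mE : measurable_fun G (EFin \o (expR \o f)).
  by apply/measurable_EFinP/measurable_funTS; exact: measurableT_comp.
rewrite lt0e integral_ge0 ?andbT; last by move=> x _; rewrite lee_fin expR_ge0.
apply/eqP => I0.
have /(ae_eq_integral_abs mu mG mE) : 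
    (\int[mu]_(x in G) `|(EFin \o (expR \o f)) x| = 0)%E.
  rewrite -I0; apply: eq_integral => x _ /=.
  by rewrite ger0_norm// expR_ge0.
case=> N [mN N0 sN]; case/andP: muG => + _; rewrite ltNge -N0 => /negP; apply.
apply: le_measure; rewrite ?inE// => x Gx; apply: sN => /= /(_ Gx)[].
by apply/eqP; rewrite gt_eqF// expR_gt0.
Qed.

(** The other factor is an average of an exponential, hence positive, so it
    cannot hide an infinite integral of [e^f]. *)
Lemma integrable_expR_of_average_mul (f g : T -> R) :
    measurable_fun setT f -> measurable_fun setT g ->
  (((mu G)^-1 * \int[mu]_(x in G) (expR (f x))%:E) *
   ((mu G)^-1 * \int[mu]_(x in G) (expR (g x))%:E) < +oo)%E ->
  mu.-integrable G (EFin \o (expR \o f)).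
Proof.
move=> mf mg fg_lty; have V_gt0 : (0 < (mu G)^-1)%E.
  by rewrite inve_muG lte_fin invr_gt0.
have f_gt0 := integral_expR_gt0 f mf; have g_gt0 := integral_expR_gt0 g mg.
apply/integrableP; split.
  by apply/measurable_EFinP/measurable_funTS; exact: measurableT_comp.
under eq_integral => x _ do rewrite /= ger0_norm ?expR_ge0//.
apply: (lty_pmul _ _ _ f_gt0 V_gt0); rewrite muleC.
by apply: lty_pmul fg_lty; exact: mule_gt0.
Qed.

Lemma integrable_of_expR (f : T -> R) : measurable_fun setT f ->
    mu.-integrable G (EFin \o (expR \o f)) ->
    mu.-integrable G (EFin \o (expR \o -%R \o f)) ->
  mu.-integrable G (EFin \o f).
Proof.
move=> mf efi eNfi; apply: le_integrable (integrableD mG efi eNfi) => //.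
  by apply/measurable_EFinP; exact: measurable_funTS.
move=> x _ /=; rewrite lee_fin [leRHS]ger0_norm ?addr_ge0 ?expR_ge0//.
by apply: (le_trans (normr_le_expRDB1 _ _)); lra.
Qed.

(** Jensen's inequality for the exponential, from its tangent line: integrate
    [e^(f - m) >= 1 + (f - m)] over [G], where [f - m] has integral zero when
    [m] is the mean of [f]. *)
Lemma mean_expR_ge1 (f : T -> R) :
  mu.-integrable G (EFin \o f) -> mu.-integrable G (EFin \o (expR \o f)) ->
  1 <= mean mu (expR \o f) G * expR (- mean mu f G).
Proof.
move=> fi efi; set m := mean mu f G.
have mE : m * fine (mu G) = \int[mu]_(x in G) f x by rewrite divfK ?gt_eqF.
rewrite /mean mulrAC ler_pdivlMr// mul1r -RintegralZr//.
have -> : fine (mu G) = \int[mu]_(x in G) ((1 - m) + f x).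
  by rewrite (RintegralD mG (integrable_cstG _) fi) Rintegral_cst// -mE mulrBl mul1r subrK.
apply: le_Rintegral => //.
- exact: (integrableD mG (integrable_cstG _) fi).
- exact: (integrableZr mG (expR (- m)) efi).
- by move=> x _; rewrite -expRD; apply: le_trans (expR_ge1Dx _); lra.
Qed.

(** The pointwise bound on [|f - m|] integrates to [A + B - 1], where
    [A = a * e^(-m)] and [B = b * e^m] are at least [1] by [mean_expR_ge1] and
    have product [a * b]. *)
Lemma mean_oscillation_le (f : T -> R) :
    mu.-integrable G (EFin \o f) ->
    mu.-integrable G (EFin \o (expR \o f)) ->
    mu.-integrable G (EFin \o (expR \o -%R \o f)) ->
  mean mu (fun x => `|f x - mean mu f G|) G <=
  mean mu (expR \o f) G * mean mu (expR \o -%R \o f) G.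
Proof.
move=> fi efi eNfi.
have Nfi : mu.-integrable G (EFin \o (-%R \o f)) by exact: integrableN fi.
have := mean_expR_ge1 f fi efi; have := mean_expR_ge1 _ Nfi eNfi.
have -> : mean mu (-%R \o f) G = - mean mu f G.
  rewrite /mean -mulNr -mulN1r -RintegralZl//; congr (_ / _).
  by apply: eq_Rintegral => x _; rewrite /= mulN1r.
rewrite opprK; set m := mean mu f G.
set a := mean _ (expR \o f) G; set b := mean _ (expR \o -%R \o f) G.
move=> B1 A1.
have -> : a * b = (a * expR (- m)) * (b * expR m).
  by rewrite [RHS]mulrACA -expRD addNr expR0 mulr1.
(* [nra] closes [A + B - 1 <= A * B] by expanding [(A - 1) * (B - 1) >= 0]. *)
apply: (@le_trans _ _ (a * expR (- m) + b * expR m - 1)); last by nra.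
have i1 : mu.-integrable G (EFin \o (fun x => expR (f x) * expR (- m))).
  exact: (integrableZr mG (expR (- m)) efi).
have i2 : mu.-integrable G (EFin \o (fun x => expR (- f x) * expR m)).
  exact: (integrableZr mG (expR m) eNfi).
have i12 := integrableD mG i1 i2; have i3 := integrable_cstG 1.
have -> : a * expR (- m) + b * expR m - 1 =
    mean mu (fun x => expR (f x) * expR (- m) + expR (- f x) * expR m - 1) G.
  rewrite /mean (RintegralB mG i12 i3) (RintegralD mG i1 i2).
  rewrite !RintegralZr// Rintegral_cst//.
  by rewrite mul1r 2!mulrDl mulNr divff ?gt_eqF// /a /b /mean !(mulrAC _ _^-1).
rewrite /mean ler_pM2r ?invr_gt0//; apply: le_Rintegral => //.
- apply: (@integrable_norm _ _ _ mu G (fun x => f x - m)).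
  exact: (integrableB mG fi (integrable_cstG m)).
- exact: (integrableB mG i12 i3).
- move=> x _; rewrite -!expRD [- f x + m]addrC -[m - f x]opprB.
  exact: normr_le_expRDB1.
Qed.

End averages.

Section inclusions.
Context {d : measure_display} {T : measurableType d} {R : realType}.
Variables (mu : {measure set T -> \bar R}) (GG : set (set T)).
Hypothesis GG_gen : generators mu GG.

Lemma Linfty_bounded_ae (f : T -> R) : (0 < mu [set: T])%E -> Linfty mu f ->
  measurable_fun setT f /\ exists M, \forall x \ae mu, `|f x| <= M.
Proof.
move=> mu_gt0; rewrite /Linfty /= inE => /andP[]; rewrite !inE /= => mf.
rewrite /finite_norm unlock mu_gt0 => fM; split => //.
exact: (@ess_supr_bounded _ _ _ mu (fun x => `|f x|)).
Qed.

(** The bound [M] on [|f|] bounds the product of the averages of [e^f] and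
    [e^(-f)] over any generator by [e^M * e^M]. *)
Lemma Linfty_sub_logA2 : (0 < mu [set: T])%E -> Linfty mu `<=` logA2 mu GG.
Proof.
move=> mu_gt0 f /(Linfty_bounded_ae _ mu_gt0)[mf [M fM]].
have average_expR_ge0 G (g : T -> R) :
    (0 <= (mu G)^-1 * \int[mu]_(x in G) (expR (g x))%:E)%E.
  apply: mule_ge0; first by rewrite inve_ge0.
  by apply: integral_ge0 => x _; rewrite lee_fin expR_ge0.
have mef : measurable_fun setT (expR \o f) by exact: measurableT_comp.
have meNf : measurable_fun setT (expR \o -%R \o f).
  by apply: measurableT_comp => //; exact: measurableT_comp.
split=> //; split=> //.
apply: (@le_lt_trans _ _ (expR M * expR M)%:E); last exact: ltry.
apply: ge_ereal_sup => _ [G /GG_gen.1[mG muG] <-].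
under [in X in (_ * X <= _)%E]eq_integral do rewrite inve_expR.
rewrite EFinM; apply: lee_pmul => //.
- apply: average_le_ae mef _ (expR_ge0 M) _ => // [x|].
    exact: expR_ge0.
  by apply: filterS fM => x; rewrite ler_norml ler_expR => /andP[].
- apply: average_le_ae meNf _ (expR_ge0 M) _ => // [x|].
    exact: expR_ge0.
  by apply: filterS fM => x; rewrite ler_norml ler_expR => /andP[+ _] /=; lra.
Qed.

(** The [A_2] supremum of [e^f] also bounds the mean oscillations of [f], by
    [mean_oscillation_le]; its finiteness provides the integrability required
    there, on each generator. *)
Lemma logA2_sub_BMO : logA2 mu GG `<=` BMO mu GG.
Proof.
move=> f [mf [_ _ A2_lty]].
have A2_ub G : GG G -> ((mu G)^-1 * (\int[mu]_(x in G) (expR (f x))%:E) *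
    ((mu G)^-1 * \int[mu]_(x in G) (expR (- f x))%:E) <=
    ereal_sup [set ((mu G)^-1 * \int[mu]_(x in G) (expR (f x))%:E) *
      ((mu G)^-1 * \int[mu]_(x in G) ((expR (f x))%:E)^-1) | G in GG])%E.
  move=> GGG; under [in X in (_ * X <= _)%E]eq_integral do rewrite -inve_expR.
  by apply: ereal_sup_ubound; exists G.
have integrable_f G : GG G -> [/\ mu.-integrable G (EFin \o f),
    mu.-integrable G (EFin \o (expR \o f)) &
    mu.-integrable G (EFin \o (expR \o -%R \o f))].
  move=> GGG; have [mG muG] := GG_gen.1 _ GGG.
  have A2_prod_lty := le_lt_trans (A2_ub _ GGG) A2_lty.
  have mNf : measurable_fun setT (-%R \o f) by exact: measurableT_comp.
  have efi := integrable_expR_of_average_mul mu G mG muG f (-%R \o f) mf mNf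
    A2_prod_lty.
  rewrite muleC in A2_prod_lty.
  have eNfi := integrable_expR_of_average_mul mu G mG muG (-%R \o f) f mNf mf
    A2_prod_lty.
  by split => //; exact: integrable_of_expR.
split.
  by split=> // G GGG; have [/integrableP[]] := integrable_f _ GGG.
apply: le_lt_trans A2_lty; apply: ge_ereal_sup => _ [G GGG <-].
have [mG muG] := GG_gen.1 _ GGG; have [fi efi eNfi] := integrable_f _ GGG.
apply: le_trans (A2_ub _ GGG).
rewrite (mean_EFin mu G mG muG _ efi) (mean_EFin mu G mG muG _ eNfi).
rewrite mean_EFin// -?EFinM ?lee_fin; first exact: mean_oscillation_le.
apply: (@integrable_norm _ _ _ mu G (fun x => f x - mean mu f G)).
exact: (integrableB mG fi (integrable_cstG mu G mG muG _)).
Qed.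

End inclusions.

Theorem proposition4p2 (d : measure_display) (T : measurableType d)
    (R : realType) (mu : {measure set T -> \bar R}) (GG : set (set T))
    (mu_gt0 : (0 < mu [set: T])%E) (mu_semifinite : semifinite mu)
    (GG_gen : generators mu GG) :
  Linfty mu `<=` logA2 mu GG /\ logA2 mu GG `<=` BMO mu GG.
Proof. by split; [exact: Linfty_sub_logA2 | exact: logA2_sub_BMO]. Qed.
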